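(* Let $n\geqslant 2$ be an even integer and let $(X,F)$ be an $n$-ary semigroup. If a neutral element can be adjoined to $(X,F)$, then $(X,F)$ is reducible.
   Context: An $n$-ary semigroup is a pair $(X,F)$, where $X$ is a nonempty set and $F\colon X^n\to X$ is associative, i.e. $$F(x_1,\ldots,x_{i-1},F(x_i,\ldots,x_{i+n-1}),x_{i+n},\ldots,x_{2n-1})=F(x_1,\ldots,x_i,F(x_{i+1},\ldots,x_{i+n}),x_{i+n+1},\ldots,x_{2n-1})$$ for all $x_1,\ldots,x_{2n-1}\in X$ and all $1\leqslant i\leqslant n-1$. $(X,F)$ is reducible if there is a (binary) semigroup $(X,\circ)$ on the same set such that $F(x_1,\ldots,x_n)=x_1\circ x_2\circ\cdots\circ x_n$ for all $x_1,\ldots,x_n\in X$. An element $e\in X$ is neutral for $F$ if $F(e^{k-1},x,e^{n-k})=x$ for every $x\in X$ and every $k\in\{1,\ldots,n\}$, where $e^j$ denotes the list $e,\ldots,e$ with $j$ copies of $e$. A neutral element can be adjoined to $(X,F)$ if there exists an $n$-ary semigroup $(X^*,F^* )$, where $X^*=X\cup\{e\}$ for some $e\notin X$, such that $F^*|_{X^n}=F$ and $e$ is neutral for $F^*$. *)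

(* Defs.v *)
From mathcomp Require Import all_boot.

Set Implicit Arguments.
Unset Strict Implicit.
Unset Printing Implicit Defensive.

(* An n-ary operation on X is a map n.-tuple X -> X, and all
   positions are counted from 0.  For n >= 1, (n.-1).*2.+1 is 2n - 1; writing it
   as a successor lets [inord] index (2n - 1)-tuples by natural numbers, and
   every index below is < 2n - 1 whenever i < n. *)

(* The n arguments x_0, .., x_(i-1), F(x_i, .., x_(i+n-1)), x_(i+n), .., x_(2n-2). *)
Definition contract (n : nat) (X : Type) (F : n.-tuple X -> X)
    (x : ((n.-1).*2.+1).-tuple X) (i : nat) : n.-tuple X :=
  [tuple if j < i then tnth x (inord j)
         else if j == i :> nat then F [tuple tnth x (inord (i + k)) | k < n]
         else tnth x (inord (j + n.-1)) | j < n].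

Definition nary_associative (n : nat) (X : Type) (F : n.-tuple X -> X) : Prop :=
  forall (x : ((n.-1).*2.+1).-tuple X) (i : nat), i.+1 < n ->
    F (contract F x i) = F (contract F x i.+1).

Definition nary_semigroup (n : nat) (X : Type) (F : n.-tuple X -> X) : Prop :=
  inhabited X /\ nary_associative F.

(* By associativity of op, the bracketing of the product is immaterial. *)
Definition reducible (n : nat) (X : Type) (F : n.-tuple X -> X) : Prop :=
  exists op : X -> X -> X, associative op /\
    forall (t : n.-tuple X) (x : X) (s : seq X),
      tval t = x :: s -> F t = foldl op x s.

Definition neutral (n : nat) (X : Type) (F : n.-tuple X -> X) (e : X) : Prop :=
  forall (x : X) (k : 'I_n), F [tuple if j == k then x else e | j < n] = x.

(* X U {e} with e not in X is [option X], with e = None and X embedded by Some. *)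
Definition neutral_adjoinable (n : nat) (X : Type) (F : n.-tuple X -> X) : Prop :=
  exists Fs : n.-tuple (option X) -> option X,
    [/\ nary_semigroup Fs,
        forall t : n.-tuple X, Fs (map_tuple Some t) = Some (F t)
      & neutral Fs None].

(* Main.v *)
Require Import Defs.
From mathcomp Require Import all_boot zify.

Set Implicit Arguments.
Unset Strict Implicit.
Unset Printing Implicit Defensive.

(** Write G for the extended operation on X U {e}, and multiply two elements by
    padding with the neutral element: x * y = G(x, y, e, .., e).

    An n-ary semigroup with a neutral element is always reducible, through this
    product. Sliding the inner bracket of a word of length 2n - 1 by one place
    shows that e commutes with every neighbour inside G ([neutral_swap]), and that
    two leading arguments x, y may be replaced by x * y, e
    ([merge_first_two]). Moving each new e to the end, one folds all the
    arguments into the first, so that G is the n-fold product ([nary_op_foldl]).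

    It remains to see that X is closed under the product, and this is where
    parity enters. If x * y = e for some x, y in X, then, n being even, the
    alternating word x, y, x, y, .., x, y of length n has product e. But all its
    arguments lie in X, so its product is a value of F, hence in X; and e is not
    in X. *)

Section NeutralElement.

Context (p : nat) (A : Type) (G : p.+2.-tuple A -> A) (e : A).
Hypotheses (assocG : nary_associative G) (neutralG : neutral G e).

(** Lists avoid size proofs in the types of the arguments. The function is meant
    for lists of size p.+2; reading shorter lists with the default e amounts to
    padding them on the right with neutral elements. *)
Definition nary_on_seq (s : seq A) : A := G [tuple nth e s i | i < p.+2].

Lemma nary_on_tuple (t : p.+2.-tuple A) : nary_on_seq t = G t.
Proof. by congr G; apply: eq_from_tnth => i; rewrite tnth_mktuple -tnth_nth. Qed.

Lemma nary_on_seq_neutral (j k : nat) (x : A) :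
  j + k = p.+1 -> nary_on_seq (nseq j e ++ x :: nseq k e) = x.
Proof.
move=> sz; have ltj : j < p.+2 by lia.
rewrite -[RHS](neutralG x (Ordinal ltj)); congr G.
apply: eq_mktuple => i.
rewrite -val_eqE /= nth_cat size_nseq nth_nseq.
case: ltngtP => [//|lt|->]; last by rewrite subnn.
case: (i - j) (subn_gt0 j i) => [|d] /=; first by rewrite lt.
by rewrite nth_nseq if_same.
Qed.

(** The defining associativity, with the two bracketings of one word of length
    2n - 1 displayed: the inner bracket slides by one place. *)
Lemma slide_bracket (a b c : seq A) (x y : A) :
    size b = p.+1 -> size a + size c = p ->
  nary_on_seq (a ++ nary_on_seq (x :: b) :: y :: c)
  = nary_on_seq (a ++ x :: nary_on_seq (rcons b y) :: c).
Proof.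
move=> szb szac; pose w := a ++ x :: b ++ y :: c.
pose t := [tuple nth e w j | j < (p.+2.-1).*2.+1].
have tE j : j < p.+1.*2.+1 -> tnth t (inord j) = nth e w j.
  by move=> lt; rewrite tnth_mktuple inordK.
have lta : (size a).+1 < p.+2 by lia.
have := assocG t lta; congr (_ = _); congr G; apply: eq_mktuple => i /=;
  have lti := ltn_ord i; rewrite nth_cat.
- case: ltngtP => [lt|lt|eqi].
  + by rewrite tE ?nth_cat ?lt //; lia.
  + rewrite tE; last by lia.
    rewrite /w nth_cat ifF; last by lia.
    have -> : i + p.+1 - size a = (size b + (i - size a).-1).+1 by lia.
    have -> : i - size a = (i - size a).-1.+1 by lia.
    rewrite /= nth_cat ifF; last by lia.
    by rewrite addKn.
  + rewrite eqi subnn /=; congr G; apply: eq_mktuple => k.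
    have ltk := ltn_ord k.
    rewrite tE; last by lia.
    rewrite /w nth_cat ifF; last by lia.
    rewrite addKn; case: (nat_of_ord k) ltk => [|d] //= ltd.
    by rewrite nth_cat ifT //; lia.
- case: (ltngtP i (size a).+1) => [lt|lt|eqi].
  + rewrite tE; last by lia.
    rewrite nth_cat; case: ltnP => // ge.
    by have -> : i - size a = 0 by lia.
  + rewrite tE; last by lia.
    rewrite ifF; last by lia.
    rewrite /w nth_cat ifF; last by lia.
    have -> : i + p.+1 - size a = (size b + (i - size a).-2.+1).+1 by lia.
    have -> : i - size a = (i - size a).-2.+2 by lia.
    rewrite /= nth_cat ifF; last by lia.
    by rewrite addKn.
  + rewrite ifF; last by lia.
    rewrite eqi subSnn /=; congr G; apply: eq_mktuple => k.
    have ltk := ltn_ord k.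
    rewrite tE; last by lia.
    rewrite /w nth_cat ifF; last by lia.
    have -> : (size a).+1 + k - size a = k.+1 by lia.
    rewrite /= nth_rcons nth_cat; case: ltnP => // ge.
    by have -> : k = size b :> nat by [lia]; rewrite eqxx subnn.
Qed.

(** Both sides bracket the word a, e, x, e^(n-1), c, where each inner bracket
    evaluates to x by neutrality. *)
Lemma neutral_swap (a c : seq A) (x : A) : size a + size c = p ->
  nary_on_seq (a ++ e :: x :: c) = nary_on_seq (a ++ x :: e :: c).
Proof.
move=> szac; have := @slide_bracket a (x :: nseq p e) c e e.
rewrite /= size_nseq => /(_ erefl szac).
rewrite (@nary_on_seq_neutral 1 p) // -cats1 -[[:: e]]/(nseq 1 e) -nseqD addn1.
by rewrite (@nary_on_seq_neutral 0 p.+1).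
Qed.

Lemma neutral_to_end (a b c : seq A) : size a + size b + size c = p.+1 ->
  nary_on_seq (a ++ e :: b ++ c) = nary_on_seq (a ++ b ++ e :: c).
Proof.
elim: b a => [|x b IH] a //= sz.
rewrite neutral_swap ?size_cat; last by lia.
by rewrite -cat_rcons IH ?size_rcons ?cat_rcons //; lia.
Qed.

Definition neutral_mul (x y : A) : A := nary_on_seq [:: x, y & nseq p e].

Lemma neutral_mul1l : left_id e neutral_mul.
Proof. by move=> x; apply: (@nary_on_seq_neutral 1 p). Qed.

(** Slide the bracket of (x * y), e, s to the right: the new inner bracket
    y, e, .., e evaluates to y. *)
Lemma merge_first_two (x y : A) (s : seq A) : size s = p ->
  nary_on_seq [:: x, y & s] = nary_on_seq [:: neutral_mul x y, e & s].
Proof.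
move=> szs; have := @slide_bracket [::] (y :: nseq p e) s x e.
rewrite /= size_nseq => /(_ erefl szs) ->.
rewrite -cats1 -[[:: e]]/(nseq 1 e) -nseqD addn1.
by rewrite (@nary_on_seq_neutral 0 p.+1).
Qed.

Lemma neutral_mulA : associative neutral_mul.
Proof.
move=> x y z; have := @slide_bracket [::] (y :: nseq p e) (nseq p e) x z.
rewrite /= size_nseq => /(_ erefl erefl) /= E.
rewrite {1}/neutral_mul [RHS]E -cats1.
(* The inner bracket is now y, e^p, z instead of y, z, e^p. *)
suff H q r (a : seq A) : size a + q + r = p.+1 ->
    nary_on_seq (a ++ nseq q e ++ z :: nseq r e)
    = nary_on_seq (a ++ z :: nseq (q + r) e).
  by rewrite (H p 0 [:: y]) ?addn0 //= addn0 add1n.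
elim: q r => [|q IH] r //= sz.
have := @neutral_to_end a (nseq q e ++ [:: z]) (nseq r e).
rewrite size_cat !size_nseq /= -!catA /= => -> //; last by lia.
by rewrite (IH r.+1) ?addnS //; lia.
Qed.

Lemma foldl_neutral_mul (x : A) (s : seq A) (k : nat) : size s + k = p.+1 ->
  nary_on_seq (x :: s ++ nseq k e) = foldl neutral_mul x s.
Proof.
elim: s x k => [|y s IH] x k /= sz.
  by rewrite (@nary_on_seq_neutral 0 k).
rewrite merge_first_two ?size_cat ?size_nseq; last by lia.
rewrite (@neutral_to_end [:: _] s) ?size_nseq /=; last by lia.
by rewrite (IH _ k.+1) //; lia.
Qed.

Lemma nary_op_foldl (t : p.+2.-tuple A) : G t = foldl neutral_mul e t.
Proof.
rewrite -nary_on_tuple; case: t => -[|x s] //= /eqP[szs].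
by rewrite neutral_mul1l -(@foldl_neutral_mul _ _ 0) ?cats0 // szs addn0.
Qed.

End NeutralElement.

Lemma foldl_alternating (A : Type) (m : A -> A -> A) (e x y : A) (k : nat) :
  left_id e m -> m x y = e -> foldl m e (flatten (nseq k [:: x; y])) = e.
Proof. by move=> m1 mxy; elim: k => //= k IH; rewrite m1 mxy. Qed.

Lemma size_alternating (A : Type) (x y : A) (k : nat) :
  size (flatten (nseq k [:: x; y])) = k.*2.
Proof. by elim: k => //= k ->. Qed.

Theorem proposition2p8 (n : nat) (X : Type) (F : n.-tuple X -> X) :
  2 <= n -> ~~ odd n -> nary_semigroup F -> neutral_adjoinable F -> reducible F.
Proof.
case: n F => [|[|p]] // F _ even_n _ [Fs [[_ assocFs] FsE neutralFs]].
pose m := neutral_mul Fs None.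
have m1 : left_id None m := neutral_mul1l neutralFs.
have mA : associative m := neutral_mulA assocFs neutralFs.
have FsM t : Fs t = foldl m None t := nary_op_foldl assocFs neutralFs t.
have closed x y : m (Some x) (Some y) <> None.
  move=> mxy; pose s := flatten (nseq p.+2./2 [:: x; y]).
  have szs : size s == p.+2 by rewrite size_alternating even_halfK.
  have := FsE (Tuple szs); rewrite FsM -[tval _]/(map Some s).
  by rewrite map_flatten map_nseq foldl_alternating.
(* The default x is never returned, by closure. *)
pose op x y := odflt x (m (Some x) (Some y)).
have opE x y : Some (op x y) = m (Some x) (Some y).
  by rewrite /op; case: (m _ _) (closed x y).
exists op; split=> [x y z | t x s def_t].
  by apply: Some_inj; rewrite !opE mA.
apply: Some_inj; rewrite -FsE FsM /= def_t /= m1.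
by elim: s x {def_t} => //= y s IH x; rewrite -opE IH.
Qed.
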